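(* Let $\mathcal{H}$ be a real Hilbert space and let $\mathcal{Y} \subset \mathcal{H}$ be non-empty. A function $f: \mathcal{Y}\to \mathcal{H}$ is a proximity operator of a function $\varphi: \mathcal{H} \to \mathbb{R} \cup \{+\infty\}$ (that is, of some such $\varphi$) if, and only if, there exists a convex lower semicontinuous function $\psi: \mathcal{H} \to \mathbb{R} \cup \{+\infty\}$ such that for each $y \in \mathcal{Y}$, $f(y) \in \partial \psi(y)$.
   Context: For $\varphi: \mathcal{H} \to \mathbb{R}\cup\{+\infty\}$ (not necessarily convex or lower semicontinuous) and $y \in \mathcal{H}$, $\mathrm{prox}_\varphi(y) := \arg\min_{x \in \mathcal{H}} \{\tfrac12\|y-x\|^2 + \varphi(x)\}$ is the (possibly empty, possibly multi-valued) set of global minimizers; a minimizer is required to have finite objective value, so $\mathrm{prox}_\varphi(y)=\varnothing$ if $\varphi\equiv+\infty$. A function $f:\mathcal{Y}\to\mathcal{H}$ is a proximity operator of $\varphi$ if $f(y) \in \mathrm{prox}_\varphi(y)$ for each $y\in\mathcal{Y}$. For $\theta:\mathcal{H}\to\mathbb{R}\cup\{+\infty\}$, the subdifferential $\partial\theta(x)$ is the set of $u\in\mathcal{H}$ with $\theta(x')\geq\theta(x)+\langle u,x'-x\rangle$ for all $x'\in\mathcal{H}$ when $\theta(x)<+\infty$, and $\partial\theta(x)=\varnothing$ when $\theta(x)=+\infty$. *)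

(* Defs.v *)
From mathcomp Require Import all_boot all_order all_algebra.
From mathcomp Require Import all_classical all_reals all_analysis.
Import Order.TTheory GRing.Theory Num.Theory.
Import numFieldNormedType.Exports.

Set Implicit Arguments.
Unset Strict Implicit.
Unset Printing Implicit Defensive.

Local Open Scope classical_set_scope.
Local Open Scope ring_scope.
Local Open Scope ereal_scope.

(* Functions H -> R \cup {+oo} are encoded as functions H -> \bar R that never
   take the value -oo. *)
Definition avoids_ninfty (R : realType) (T : Type) (theta : T -> \bar R) :=
  forall x : T, theta x != -oo.

(* The library's convex_function is restricted to real-valued functions.  With
   t in the open unit interval, no product 0 * +oo occurs. *)
Definition convex_efunction (R : realType) (H : lmodType R)
    (theta : H -> \bar R) :=
  forall (x x' : H) (t : R), (0 < t < 1)%R ->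
    theta (t *: x + (1 - t) *: x')%R
      <= t%:E * theta x + (1 - t)%:E * theta x'.

Definition prox_objective (R : realType) (H : normedModType R)
    (phi : H -> \bar R) (y x : H) : \bar R :=
  (2^-1 * `|y - x| ^+ 2)%:E + phi x.

Definition prox (R : realType) (H : normedModType R)
    (phi : H -> \bar R) (y : H) : set H :=
  [set x | prox_objective phi y x \is a fin_num /\
           forall x' : H, prox_objective phi y x <= prox_objective phi y x'].

Definition is_proximity_operator (R : realType) (H : normedModType R)
    (Y : set H) (f : Y -> H) (phi : H -> \bar R) :=
  forall y : Y, prox phi (val y) (f y).

Definition subdifferential (R : realType) (H : lmodType R)
    (inner : {dot H for idfun}) (theta : H -> \bar R) (x : H) : set H :=
  [set u | theta x < +oo /\
           forall x' : H, theta x + (inner u (x' - x)%R)%:E <= theta x'].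

(* Main.v *)
(** Expanding the square, [f y] minimizes [|y - x|^2 / 2 + phi x] if and only if
    it maximizes [<y, x> - (phi x + |x|^2 / 2)].  Hence, given [phi], the
    supremum over [y] in [Y] of the affine functions
    [z |-> <f y, z> - phi (f y) - |f y|^2 / 2] is attained at [z = y] by the
    index [y], which makes [f y] a subgradient there.  Conversely, given [psi],
    the supremum over [y] in [Y] of the affine functions
    [x |-> <y, x> - psi y] is attained at [x = f y] by the index [y], and
    subtracting [|x|^2 / 2] from it yields [phi].  Conjugates restricted to [Y]
    thus suffice in both directions. *)

Require Import Defs.
From mathcomp Require Import all_boot all_order all_algebra.
From mathcomp Require Import all_classical all_reals all_analysis.
From mathcomp Require Import ring lra.
Import Order.TTheory GRing.Theory Num.Theory.
Import numFieldNormedType.Exports.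

Set Implicit Arguments.
Unset Strict Implicit.
Unset Printing Implicit Defensive.

Local Open Scope classical_set_scope.
Local Open Scope ring_scope.

(** Slopes and offsets are arbitrary families, so that one construction serves both directions:
    slopes [f y] to build [psi], slopes [val y] to build [phi]. *)
Definition affine_sup (R : realType) (H : lmodType R)
    (inner : {dot H for idfun}) (I : Type) (a : I -> H) (c : I -> R) (z : H) :
    \bar R :=
  ereal_sup (range (fun i => (inner (a i) z + c i)%:E)).

Section AffineSup.
Variables (R : realType) (H : lmodType R) (inner : {dot H for idfun}).
Variables (I : Type) (a : I -> H) (c : I -> R).

Lemma affine_sup_ge (i : I) (z : H) :
  ((inner (a i) z + c i)%:E <= affine_sup inner a c z)%E.
Proof. by apply: ereal_sup_ubound; exists i. Qed.

Lemma affine_sup_le (z : H) (M : \bar R) :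
  (forall i, ((inner (a i) z + c i)%:E <= M)%E) ->
  (affine_sup inner a c z <= M)%E.
Proof. by move=> leM; apply: ge_ereal_sup => _ [i _ <-]. Qed.

Lemma affine_sup_attained (i : I) (z : H) :
  (forall j, inner (a j) z + c j <= inner (a i) z + c i) ->
  affine_sup inner a c z = (inner (a i) z + c i)%:E.
Proof.
move=> max_i; apply/le_anti; rewrite affine_sup_ge andbT.
by apply: affine_sup_le => j; rewrite lee_fin.
Qed.

Lemma affine_sup_gtNy (i : I) (z : H) : (-oo < affine_sup inner a c z)%E.
Proof. exact: lt_le_trans (ltNyr _) (affine_sup_ge i z). Qed.

Lemma affine_sup_avoids_ninfty (i : I) : avoids_ninfty (affine_sup inner a c).
Proof. by move=> z; rewrite -ltNye; exact: affine_sup_gtNy i z. Qed.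

Lemma affine_sup_convex : convex_efunction (affine_sup inner a c).
Proof.
move=> x x' t /andP[t0 t1]; apply: affine_sup_le => i.
have -> : inner (a i) (t *: x + (1 - t) *: x') + c i =
    t * (inner (a i) x + c i) + (1 - t) * (inner (a i) x' + c i).
  by rewrite linearDr !linearZr_LR /=; ring.
rewrite EFinD !EFinM leeD// lee_wpmul2l ?affine_sup_ge// lee_fin; lra.
Qed.

End AffineSup.

Section InnerProduct.
Variables (R : realType) (H : normedModType R) (inner : {dot H for idfun}).
Hypothesis inner_norm : forall x : H, inner x x = `|x| ^+ 2.

Lemma innerC (x y : H) : inner x y = inner y x.
Proof. by rewrite hermC expr0 mul1r. Qed.

Lemma innerBr (u x y : H) : inner u (x - y) = inner u x - inner u y.
Proof. exact: linearBr. Qed.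

Lemma half_normB_sqr (x y : H) :
  2^-1 * `|x - y| ^+ 2 = 2^-1 * `|x| ^+ 2 - inner x y + 2^-1 * `|y| ^+ 2.
Proof.
rewrite -!inner_norm innerBr innerC (innerC _ y) !innerBr (innerC y x); lra.
Qed.

(* Polarization reduces this to the continuity of the norm. *)
Lemma inner_continuous (u : H) : continuous (inner u).
Proof.
have -> : inner u = fun z =>
    2^-1 * `|u| ^+ 2 + 2^-1 * (`|z| * `|z|) - 2^-1 * (`|u - z| * `|u - z|).
  by apply/funext => z; rewrite -!expr2 half_normB_sqr; ring.
have norm_cvg (z : H) : `|t| @[t --> z] --> `|z| by exact: norm_continuous.
have normB_cvg (z : H) : `|u - t| @[t --> z] --> `|u - z|.
  by apply: cvg_norm; apply: cvgB; [exact: cvg_cst | exact: cvg_id].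
move=> z; apply: cvgB.
  by apply: cvgD; [exact: cvg_cst | apply: cvgMl_tmp; apply: cvgM; exact: norm_cvg].
by apply: cvgMl_tmp; apply: cvgM; exact: normB_cvg.
Qed.

(** If the supremum exceeds [r] at [x], a single affine function already does, and by continuity it
    does so near [x]. *)
Lemma affine_sup_lower_semicontinuous (I : Type) (a : I -> H) (c : I -> R) :
  lower_semicontinuous (affine_sup inner a c).
Proof.
move=> x r /ereal_sup_gt[_ [i _ <-]]; rewrite lte_fin => r_lt.
exists [set z | r < inner (a i) z + c i]; last first.
  by move=> z r_z; apply: lt_le_trans (affine_sup_ge _ _ _ i z); rewrite lte_fin.
have cvg_i : inner (a i) z + c i @[z --> x] --> inner (a i) x + c i.
  by apply: cvgD; [exact: inner_continuous | exact: cvg_cst].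
exact: cvgr_gt cvg_i _ r_lt.
Qed.

Variables (Y : set H) (Y_nonempty : Y !=set0) (f : Y -> H).

Lemma proximity_operator_subgradient (phi : H -> \bar R) :
  is_proximity_operator f phi ->
  exists psi : H -> \bar R,
    [/\ avoids_ninfty psi, convex_efunction psi, lower_semicontinuous psi &
        forall y : Y, subdifferential inner psi (val y) (f y)].
Proof.
move=> prox_f; have [y0 Yy0] := Y_nonempty.
have phi_fin (y : Y) : phi (f y) \is a fin_num.
  by have [+ _] := prox_f y; rewrite /prox_objective fin_numD => /andP[].
pose c (y : Y) := - (2^-1 * `|f y| ^+ 2 + fine (phi (f y))).
have sup_val (y : Y) :
    affine_sup inner f c (val y) = (inner (f y) (val y) + c y)%:E.
  apply: affine_sup_attained => y'.
  (* Minimality of [f y] is tested against [f y']; the terms in the norm of [y] cancel. *)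
  have [_ /(_ (f y'))] := prox_f y; rewrite /prox_objective.
  rewrite -(fineK (phi_fin y)) -(fineK (phi_fin y')) -!EFinD lee_fin.
  rewrite !half_normB_sqr /c (innerC (f y)) (innerC (f y')); lra.
exists (affine_sup inner f c); split.
(* A point of [Y] provides an index, which keeps the supremum above [-oo]. *)
- exact: affine_sup_avoids_ninfty (SigSub (mem_set Yy0)).
- exact: affine_sup_convex.
- exact: affine_sup_lower_semicontinuous.
- move=> y; split=> [|x']; rewrite sup_val ?ltry// -EFinD.
  apply: le_trans (affine_sup_ge _ _ _ y x').
  by rewrite lee_fin innerBr; lra.
Qed.

Lemma subgradient_proximity_operator (psi : H -> \bar R) :
  avoids_ninfty psi ->
  (forall y : Y, subdifferential inner psi (val y) (f y)) ->
  exists phi : H -> \bar R, avoids_ninfty phi /\ is_proximity_operator f phi.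
Proof.
move=> psiNy sub_f; have [y0 Yy0] := Y_nonempty.
have psi_fin (y : Y) : psi (val y) \is a fin_num.
  by have [psi_lty _] := sub_f y; rewrite fin_numE psiNy -ltey.
pose c (y : Y) := - fine (psi (val y)).
pose S := affine_sup inner (val : Y -> H) c.
have S_f (y : Y) : S (f y) = (inner (val y) (f y) + c y)%:E.
  apply: affine_sup_attained => y'.
  (* The subgradient inequality at [y], tested at [y'], says that index [y] is maximal at [f y]. *)
  have [_ /(_ (val y'))] := sub_f y.
  rewrite -(fineK (psi_fin y)) -(fineK (psi_fin y')) -EFinD lee_fin.
  rewrite innerBr /c (innerC (val y)) (innerC (val y')); lra.
pose phi x := (S x + (- (2^-1 * `|x| ^+ 2))%:E)%E.
(* The squared norms of [x] cancel. Only real terms are combined, as [S x] may be [+oo]. *)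
have objE y x : prox_objective phi y x =
    (S x + (2^-1 * `|y| ^+ 2 - inner y x)%:E)%E.
  rewrite /prox_objective /phi addeCA -EFinD half_normB_sqr.
  by congr (_ + _%:E)%E; ring.
exists phi; split=> [x|y].
  rewrite /phi adde_eq_ninfty negb_or andbT.
  exact: affine_sup_avoids_ninfty (SigSub (mem_set Yy0)) x.
split=> [|x']; rewrite !objE S_f -EFinD//.
(* Bounding [S x'] below by its affine function of index [y] cancels the inner product with [x'] and
   leaves the value attained at [f y]. *)
apply: le_trans (leeD2r _ (affine_sup_ge _ _ _ y x')).
by rewrite -EFinD lee_fin; lra.
Qed.

End InnerProduct.

(* H, with its inner product inducing its complete norm, is a real Hilbert
   space. *)
Theorem theorem1 (R : realType) (H : completeNormedModType R)
    (inner : {dot H for idfun})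
    (inner_norm : forall x : H, inner x x = `|x| ^+ 2)
    (Y : set H) (Y_nonempty : Y !=set0) (f : Y -> H) :
  (exists phi : H -> \bar R,
      avoids_ninfty phi /\ is_proximity_operator f phi)
  <->
  (exists psi : H -> \bar R,
      [/\ avoids_ninfty psi, convex_efunction psi, lower_semicontinuous psi &
          forall y : Y, subdifferential inner psi (val y) (f y)]).
Proof.
split=> [[phi [_ prox_f]] | [psi [psiNy _ _ sub_f]]].
- exact: proximity_operator_subgradient prox_f.
- exact: subgradient_proximity_operator sub_f.
Qed.
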